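(* Let $G$ be a finite abelian group, let $k \geq 1$ be a positive integer, and let $S$ be a sequence over $G$ of length $|S| \geq k+1$. Suppose $0 \notin \Sigma_{\geq k}(S)$ and $0\notin \mathrm{supp}(S)$. Then $|\Sigma_{\geq k}(S)|\geq |S|-k+|\mathrm{supp}(S)|$.
   Context: $G$ is written additively. A sequence over $G$ is a finite unordered sequence (multiset) of elements of $G$, repetition allowed: $S=g_1\cdot\ldots\cdot g_\ell=\prod_{g\in G} g^{\mathsf v_g(S)}$, where $\mathsf v_g(S)\ge 0$ is the multiplicity of $g$ in $S$. $|S|=\ell$ is the length of $S$ (counted with multiplicity), $\mathrm{supp}(S)=\{g\in G: \mathsf v_g(S)>0\}$ is the set of distinct terms, and $\sigma(S)=g_1+\cdots+g_\ell\in G$ is the sum. A subsequence $T$ of $S$ is a sequence with $\mathsf v_g(T)\le \mathsf v_g(S)$ for all $g\in G$. For $t\in[1,|S|]$, $\Sigma_t(S)=\{\sigma(T): T \text{ is a subsequence of } S \text{ with } |T|=t\}$, and $\Sigma_{\geq k}(S)=\bigcup_{t=k}^{|S|}\Sigma_t(S)$. *)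

(* Defs.v *)
From mathcomp Require Import all_boot all_order all_algebra.
From mathcomp Require Import finmap multiset.
From mathcomp Require Import boolp.

Set Implicit Arguments.
Unset Strict Implicit.
Unset Printing Implicit Defensive.

Local Open Scope mset_scope.
Local Open Scope ring_scope.

(* A sequence over G is a multiset S : {mset G}: the multiplicity of g is S g,
   the length is size S (through the coercion of multisets to lists), and the
   set of distinct terms is finsupp S. *)

Definition seqsum (G : finZmodType) (S : {mset G}) : G := \sum_(g <- S) g.

(* The multisets over G do not form a finite type, so `[< _ >] is used to turn
   the existential into a boolean membership predicate. *)
Definition Sigma (G : finZmodType) (t : nat) (S : {mset G}) : {set G} :=
  [set x | `[< exists T : {mset G},
                 [/\ (T `<=` S)%mset, size T = t & seqsum T = x] >]].

Definition Sigma_ge (G : finZmodType) (k : nat) (S : {mset G}) : {set G} :=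
  \bigcup_(k <= t < (size S).+1) Sigma t S.

(* Main.v *)
(* Write B for the set of sums of at least k terms of S, and argue by induction
   on |G|, then on |S|.  If B is a union of cosets of a nontrivial subgroup H,
   the terms of S lying in H number fewer than k, and the induction hypothesis
   for the image in G/H of the other terms suffices.  If B is aperiodic,
   deleting any term g strictly shrinks B.  Hence in a minimal counterexample
   the terms are distinct, deleting g costs exactly one element of B, and so
   exactly one b in B has b - g outside B.  Take a longest subsequence whose
   sum y is not in B: looking at these exits from B shows that B together with
   y is stable under subtraction of every term, whence y = 0.  Then B contains
   the support X and -X, and has size at most 2|X| - k - 1, so X meets -X in
   many elements; deleting a few involutions from this intersection leaves a
   zero-sum set of size at least k, a contradiction. *)

From HB Require Import structures.
Require Import Defs.
From mathcomp Require Import all_boot all_order all_algebra all_fingroup.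
From mathcomp Require Import finmap multiset.
From mathcomp Require boolp.
From mathcomp Require Import zify.

Set Implicit Arguments.
Unset Strict Implicit.
Unset Printing Implicit Defensive.

Import GRing.Theory.

Local Open Scope mset_scope.
Local Open Scope ring_scope.

(* [coset_of H] is only known to be a multiplicative, possibly noncommutative,
   group; this alias carries the additive structure inherited from [G]. *)
Definition zquot (G : finZmodType) (H : {group G}) : Type := coset_of H.

(** * Quotients of finite abelian groups, written additively *)

Section ZmodQuotient.

Variables (G : finZmodType) (H : {group G}).

HB.instance Definition _ := Finite.on (zquot H).

Lemma zmod_normed (x : G) : x \in 'N(H)%g.
Proof.
have /subsetP := sub_abelian_norm (FinRing.zmod_abelian [set: G]) (subsetT H).
by apply; rewrite inE.
Qed.

Definition zquot_add (x y : zquot H) : zquot H := (x * y)%g.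
Definition zquot_opp (x : zquot H) : zquot H := (x^-1)%g.

Lemma zquot_addA : associative zquot_add. Proof. exact: mulgA. Qed.

Lemma zquot_addC : commutative zquot_add.
Proof.
move=> x y; case: (cosetP x) => a Na ->; case: (cosetP y) => b Nb ->.
by rewrite /zquot_add -!morphM //; congr (coset H _); apply: addrC.
Qed.

Lemma zquot_add0 : left_id (1%g : zquot H) zquot_add.
Proof. exact: mul1g. Qed.

Lemma zquot_addN : left_inverse (1%g : zquot H) zquot_opp zquot_add.
Proof. exact: mulVg. Qed.

HB.instance Definition _ :=
  GRing.isZmodule.Build (zquot H) zquot_addA zquot_addC zquot_add0 zquot_addN.

Definition zproj (x : G) : zquot H := coset H x.

Lemma zprojD : {morph zproj : x y / x + y}.
Proof. by move=> x y; apply: (morphM (coset_morphism H)); apply: zmod_normed. Qed.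

Lemma zproj0 : zproj 0 = 0.
Proof. exact: (morph1 (coset_morphism H)). Qed.

Lemma zproj_eq0 (x : G) : (zproj x == 0) = (x \in H).
Proof.
apply/eqP/idP => [e|xH]; last exact: coset_id.
exact: coset_idr (zmod_normed x) e.
Qed.

Lemma zproj_sum (I : finType) (P : pred I) (F : I -> G) :
  zproj (\sum_(i | P i) F i) = \sum_(i | P i) zproj (F i).
Proof. exact: (big_morph zproj zprojD zproj0). Qed.

Lemma zproj_eq (x y : G) : (zproj x == zproj y) = (x - y \in H).
Proof.
rewrite -zproj_eq0 -(inj_eq (addIr (zproj (- y)))) -!zprojD subrr zproj0.
by [].
Qed.

Lemma card_zproj_preim (X : {set zquot H}) :
  #|zproj @^-1: X| = (#|H| * #|X|)%N.
Proof.
rewrite -sum1_card (partition_big zproj (mem X)) /=; last first.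
  by move=> i; rewrite inE.
rewrite mulnC -sum_nat_const; apply: eq_bigr => y yX.
have [a ay] : exists a, y = zproj a by case: (cosetP y) => a; exists a.
rewrite sum1_card -[in RHS](card_imset _ (addrI a)); apply: eq_card => x.
rewrite unfold_in inE andb_idl; last by move=> /eqP ->.
rewrite ay zproj_eq; apply/idP/imsetP => [xaH|[h hH ->]].
  by exists (x - a); rewrite // addrC subrK.
by rewrite addrC addKr.
Qed.

End ZmodQuotient.

(** * Sums of at least [k] terms of an indexed family *)

(** Indices carry the multiplicities: equal terms have distinct indices, so subsequences become
    subsets of a finite type. *)
Definition subsums (G : finZmodType) (I : finType) (f : I -> G) (k : nat)
    (J : {set I}) : {set G} :=
  [set \sum_(i in T) f i
     | T : {set I} in [pred T : {set I} | (T \subset J) && (k <= #|T|)%N]].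

Definition subsums_bound (G : finZmodType) (I : finType) (f : I -> G) (k : nat)
    (J : {set I}) : Prop :=
  0 \notin subsums f k J -> {in J, forall i, f i != 0} -> (k < #|J|)%N ->
  (#|J| + #|f @: J| <= #|subsums f k J| + k)%N.

Section Subsums.

Variables (G : finZmodType) (I : finType) (f : I -> G).
Implicit Types (J T : {set I}) (k : nat).

Lemma subsumsP k J x :
  reflect (exists T, [/\ T \subset J, (k <= #|T|)%N & x = \sum_(i in T) f i])
          (x \in subsums f k J).
Proof.
apply: (iffP imsetP) => [[T]|[T [TJ kT ->]]]; last by exists T; rewrite // inE TJ.
by rewrite inE => /andP[TJ kT] ->; exists T.
Qed.

Lemma mem_subsums k J T :
  T \subset J -> (k <= #|T|)%N -> \sum_(i in T) f i \in subsums f k J.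
Proof. by move=> TJ kT; apply/subsumsP; exists T. Qed.

Lemma subsums_sub k J J' : J' \subset J -> subsums f k J' \subset subsums f k J.
Proof.
move=> sJ; apply/subsetP => _ /subsumsP[T [TJ kT ->]].
by apply: mem_subsums; rewrite ?(subset_trans TJ).
Qed.

Lemma subsumsD1 k J j x :
  j \in J -> x \in subsums f k (J :\ j) -> x + f j \in subsums f k J.
Proof.
move=> jJ /subsumsP[T [TJ kT ->]].
have jT : j \notin T by apply/negP => /(subsetP TJ); rewrite !inE eqxx.
have -> : \sum_(i in T) f i + f j = \sum_(i in j |: T) f i.
  by rewrite big_setU1 //= addrC.
apply: mem_subsums; last by rewrite cardsU1 jT (leq_trans kT) // leq_addl.
by rewrite subUset sub1set jJ (subset_trans TJ) // subsetDl.
Qed.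

End Subsums.

(** * The periodic case and the base case of the induction *)

(** Terms in [H] can be appended to a sum without changing its class, so they lower the number of
    terms still required in the quotient; each class reached there contributes a whole coset to the
    set of sums. *)
Lemma subsums_bound_periodic (G : finZmodType) (I : finType) (f : I -> G)
    (k : nat) (J : {set I}) (H : {group G}) :
  (1 < #|H|)%N ->
  {in subsums f k J & H, forall b h, b + h \in subsums f k J} ->
  let J' := [set i in J | f i \notin H] in
  subsums_bound (fun i => zproj H (f i)) (k - #|J :\: J'|) J' ->
  subsums_bound f k J.
Proof.
move=> H1 stab J' IH B0 nz kJ.
set B := subsums f k J in B0 stab *.
set JH := J :\: J'.
have sJ' : J' \subset J by apply/subsetP => i; rewrite inE => /andP[].
have JHH i : i \in JH -> f i \in H.
  by rewrite !inE => /andP[+ iJ]; rewrite iJ /= negbK.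
have sumJH : zproj H (\sum_(i in JH) f i) = 0.
  rewrite zproj_sum big1 // => i /JHH; rewrite -zproj_eq0; exact: eqP.
have BH0 b : b \in B -> zproj H b <> 0.
  move=> bB /eqP; rewrite zproj_eq0 => bH; case/negP: B0.
  by rewrite -(subrr b); apply: stab; rewrite // (groupVr bH).
have disjT (T : {set I}) : T \subset J' -> [disjoint T & JH].
  move=> TJ'; rewrite disjoints_subset; apply/subsetP => i /(subsetP TJ') iJ.
  by rewrite /JH in_setC in_setD iJ.
have sumT (T : {set I}) : T \subset J' -> (k - #|JH| <= #|T|)%N ->
    exists2 b, b \in B & zproj H b = zproj H (\sum_(i in T) f i).
  move=> TJ' kT; exists (\sum_(i in T :|: JH) f i).
    apply: mem_subsums; first by rewrite subUset (subset_trans TJ') ?subsetDl.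
    by rewrite cardsU disjoint_setI0 ?disjT // cards0 subn0 addnC -leq_subLR.
  rewrite (eq_bigl [predU T & JH]); last by move=> i; rewrite inE.
  by rewrite bigU ?disjT //= zprojD sumJH addr0.
have cJH : (#|JH| + #|J'| = #|J|)%N.
  by rewrite cardsD (setIidPr sJ') subnK // subset_leq_card.
(* Otherwise the terms in [H] alone would give a sum of class 0. Hence the truncated subtraction
   [k - #|JH|] is exact. *)
have kH : (#|JH| < k)%N.
  rewrite ltnNge; apply/negP => kH.
  have : \sum_(i in JH) f i \in B by apply: mem_subsums; rewrite // subsetDl.
  by move/BH0.
rewrite /subsums_bound -/JH in IH.
set B' := subsums _ _ J' in IH.
have {IH} : (#|J'| + #|[set zproj H (f i) | i in J']| <= #|B'| + (k - #|JH|))%N.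
  apply: IH; last by rewrite -/JH; lia.
  - apply/negP => /subsumsP[T [TJ' kT]]; rewrite -zproj_sum.
    by have [b bB <-] := sumT T TJ' kT => /esym /BH0; apply.
  - by move=> i; rewrite inE zproj_eq0 => /andP[].
have cB : (#|H| * #|B'| <= #|B|)%N.
  rewrite -card_zproj_preim; apply/subset_leq_card/subsetP => x.
  rewrite inE => /subsumsP[T [TJ' kT]]; rewrite -zproj_sum => xT.
  have [b bB bT] := sumT T TJ' kT.
  rewrite -[x](subrK b) addrC; apply: stab => //.
  by rewrite -zproj_eq xT bT.
set s := #|[set zproj H (f i) | i in J']|.
(* Values in [H] avoid 0; all others lie over [s] nonzero classes. *)
have cs : (#|f @: J| <= (#|H| - 1) + #|H| * s)%N.
  have -> : (#|H| - 1 = #|(H : {set G}) :\ (0%R : G)|)%N.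
    by rewrite [in LHS](cardsD1 (0%R : G)) group1 addKn.
  rewrite -card_zproj_preim -cardsUI; apply: leq_trans (leq_addr _ _).
  apply/subset_leq_card/subsetP => _ /imsetP[i iJ ->]; rewrite !inE nz //=.
  have [//|/= nH] := boolP (f i \in H).
  by apply/imsetP; exists i; rewrite // inE iJ.
(* As [j' - (k - jh) = j - k >= 1], the bound follows from [h * (j - k + s) >= (j - k) + (h - 1) + h
   * s]. *)
move: #|H| #|B'| #|B| #|J'| #|JH| #|J| #|f @: J| H1 cB cs cJH kH kJ.
by move=> h b' b j' jh j p H1 cB cs cJH kH kJ IH; nia.
Qed.

(** The total sum, and the total sum minus one term, already give enough elements; they differ
    because no term is 0. *)
Lemma subsums_bound_card (G : finZmodType) (I : finType) (f : I -> G)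
    (k : nat) (J : {set I}) :
  #|J| = k.+1 -> subsums_bound f k J.
Proof.
move=> cJ _ nz _; rewrite cJ addSnnS addnC leq_add2r.
set s := \sum_(i in J) f i.
have <- : #|[set s - x | x in (0%R : G) |: f @: J]| = #|f @: J|.+1.
  rewrite (card_imset _ (inv_inj (subKr s))).
  rewrite cardsU1; case: imsetP => // -[i iJ] /esym/eqP.
  by rewrite (negPf (nz i iJ)).
apply/subset_leq_card/subsetP => _ /imsetP[x + ->].
case/setU1P => [->|/imsetP[i iJ ->]].
  by rewrite subr0; apply: mem_subsums; rewrite ?cJ.
have -> : s - f i = \sum_(j in J :\ i) f j.
  by rewrite /s (big_setD1 i iJ) /= [LHS]addrC addKr.
apply: mem_subsums; first exact: subsetDl.
by move: cJ; rewrite (cardsD1 i J) iJ; lia.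
Qed.

(** * Stable sets and zero-sum subsets *)

Lemma sum_oppr_closed (G : finZmodType) (N : {set G}) :
  (forall v, v \in N -> - v \in N) -> (forall v, v \in N -> - v != v) ->
  \sum_(v in N) v = 0.
Proof.
move=> NN ne; have NNE v : (- v \in N) = (v \in N).
  by apply/idP/idP => /NN //; rewrite opprK.
pose r (v : G) := enum_rank v.
(* An enumeration of [G] selects one element from each pair [v], [- v]. *)
rewrite (bigID [pred v | (r v < r (- v)%R)%N]) /=.
rewrite [X in _ + X](reindex_inj oppr_inj) /= sumrN.
apply/eqP; rewrite subr_eq0; apply/eqP; apply: eq_bigl => v.
rewrite NNE opprK; case vN: (v \in N) => //=.
rewrite -leqNgt ltn_neqAle andb_idl // => _; apply/eqP.
by move=> /ord_inj/enum_rank_inj/esym/eqP; apply/negP; apply: ne.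
Qed.

(** An injective self-map of a finite set is onto. *)
Lemma stable_addr (G : finZmodType) (D : {set G}) (v : G) :
  {in D, forall d, d - v \in D} -> {in D, forall d, d + v \in D}.
Proof.
move=> DB d dD; have /eqP E : [set x - v | x in D] == D.
  rewrite eqEcard card_imset ?leqnn ?andbT; last exact: addIr.
  by apply/subsetP => _ /imsetP[x xD ->]; apply: DB.
by move: dD; rewrite -{1}E => /imsetP[x xD ->]; rewrite subrK.
Qed.

Lemma stable_sub_sum (G : finZmodType) (D : {set G}) (I : finType) (T : {set I})
    (F : I -> G) :
  {in D & T, forall d i, d - F i \in D} ->
  {in D, forall d, d - \sum_(i in T) F i \in D}.
Proof.
move=> DB; elim/big_ind: _ => [d|x y Dx Dy d dD|i iT d dD].
- by rewrite subr0.
- by rewrite opprD addrA; apply/Dy/Dx.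
- exact: DB.
Qed.

(** Both [X] and its negative lie in [D] without 0, so counting makes their intersection [T] exceed
    [#|E| + k]. Outside the involutions [Q], [T] cancels in pairs, so it suffices to delete at most
    [#|E| + 1] elements whose sum is that of [Q]. *)
Lemma zero_sum_subset (G : finZmodType) (D X : {set G}) (k : nat) :
  0 \in D -> {in D & X, forall d v, d - v \in D} -> 0 \notin X ->
  (#|D| + k <= #|X| + #|X|)%N ->
  exists Y : {set G}, [/\ Y \subset X, (k <= #|Y|)%N & \sum_(v in Y) v = 0].
Proof.
move=> D0 DB X0 cD.
have DD : {in D & X, forall d v, d + v \in D}.
  by move=> d v dD vX; apply: stable_addr => // e eD; apply: DB.
pose X' : {set G} := [set - v | v in X].
have X'E v : (v \in X') = (- v \in X).
  by rewrite -{1}[v]opprK (mem_imset _ _ oppr_inj).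
pose T : {set G} := X :&: X'; pose Q : {set G} := [set v in X | v + v == 0].
have QT : Q \subset T.
  apply/subsetP => v; rewrite !inE X'E addr_eq0 => /andP[vX /eqP <-].
  by rewrite vX.
have TX : T \subset X by apply: subsetIl.
pose D' : {set G} := D :\ 0%R.
pose E : {set G} := D' :\: (X :|: X').
have sXD : X :|: X' \subset D'.
  apply/subsetP => v; rewrite !inE X'E => /orP[vX|vX]; apply/andP; split.
  - by apply: contraNneq X0 => <-.
  - by rewrite -[v]add0r DD.
  - by apply: contraNneq X0 => v0; rewrite v0 oppr0 in vX.
  - by rewrite -[v]opprK -[- - v]add0r DB.
have cT : (#|E| + k < #|T|)%N.
  have c1 : (#|X :|: X'| + #|T| = #|X| + #|X|)%N.
    by rewrite cardsUI (card_imset _ oppr_inj).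
  have c2 : (#|D| = #|D'|.+1)%N by rewrite (cardsD1 (0%R : G)) D0.
  have c3 : (#|E| + #|X :|: X'| = #|D'|)%N.
    by rewrite cardsD (setIidPr sXD) subnK // subset_leq_card.
  by lia.
have sumN : \sum_(v in T :\: Q) v = 0.
  apply: sum_oppr_closed => v; rewrite !inE !X'E ?opprK.
    move=> /and3P[vQ vX nvX]; rewrite vX nvX /= andbT.
    by rewrite -opprD oppr_eq0; move: vQ; rewrite vX.
  move=> /and3P[vQ vX nvX]; apply: contra vQ => /eqP e.
  by rewrite vX /= -{1}e addNr.
pose t := \sum_(v in Q) v.
have sumT : \sum_(v in T) v = t.
  by rewrite (big_setID Q) /= (setIidPr QT) sumN addr0.
have tt : t + t = 0.
  rewrite /t -big_split big1 //= => v; rewrite inE => /andP[_]; exact: eqP.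
have dropT (R : {set G}) : R \subset T -> \sum_(v in R) v = t ->
    (#|R| <= #|E|.+1)%N ->
    exists Y : {set G}, [/\ Y \subset X, (k <= #|Y|)%N & \sum_(v in Y) v = 0].
  move=> RT sR cR; exists (T :\: R); split.
  - by rewrite (subset_trans _ TX) ?subsetDl.
  - by rewrite cardsD (setIidPr RT); lia.
  - move: sumT; rewrite (big_setID R) /= (setIidPr RT) sR -[RHS]addr0.
    exact: addrI.
have [t0|t0] := eqVneq t 0.
  by apply: (dropT set0); rewrite ?sub0set ?cards0 // big_set0 t0.
have [tX|tX] := boolP (t \in X).
  apply: (dropT [set t]); rewrite ?cards1 // ?big_set1 // sub1set.
  by apply: (subsetP QT); rewrite inE tX tt eqxx.
have tD : t \in D.
  rewrite -[t]add0r; apply: stable_addr => //; apply: stable_sub_sum => d v dD.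
  by rewrite inE => /andP[vX _]; apply: DB.
(* Now [E] is nonempty, so two elements may be deleted. *)
have tE : t \in E.
  rewrite !inE t0 tD X'E (negPf tX) /= andbT.
  by have /eqP <- : t == - t by rewrite -addr_eq0 tt.
(* Remove from [T] either two involutions with sum [t], or all of [Q]; in the
   latter case [t + Q] injects into [E], which makes [Q] small enough. *)
have [/existsP[s /andP[sQ tsQ]]|nQ] := boolP [exists s in Q, t + s \in Q].
  have ss : s + s = 0 by move: sQ; rewrite inE => /andP[_ /eqP].
  have nts : t + s != s by rewrite -subr_eq0 addrK.
  apply: (dropT [set t + s; s]).
  - by rewrite subUset !sub1set !(subsetP QT).
  - by rewrite big_setU1 ?inE //= big_set1 -addrA ss addr0.
  - rewrite cards2 nts ltnS; apply/card_gt0P; by exists t.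
apply: (dropT Q) => //; apply: leqW.
rewrite -(card_imset _ (addrI t)).
apply/subset_leq_card/subsetP => _ /imsetP[s sQ ->].
have [sX ss] : s \in X /\ s + s = 0 by move: sQ; rewrite inE => /andP[sX /eqP].
have tsQ : t + s \notin Q.
  by apply: contra nQ => tsQ; apply/existsP; exists s; rewrite sQ.
have ts2 : t + s + (t + s) = 0 by rewrite addrACA tt ss addr0.
have tsX : t + s \notin X by move: tsQ; rewrite inE ts2 eqxx andbT.
have tsN : - (t + s) = t + s by apply/esym/eqP; rewrite -addr_eq0 ts2.
rewrite !inE X'E tsN (negPf tsX) DD // andbT /=.
rewrite addr_eq0; apply: contraNneq tX => ->.
by have /eqP <- : s == - s by rewrite -addr_eq0 ss.
Qed.

(** * The aperiodic case *)

Lemma subsums_bound_aperiodic (G : finZmodType) (I : finType) (f : I -> G)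
    (k : nat) (J : {set I}) :
  (forall h, h != 0 -> ~ {in subsums f k J, forall b, b + h \in subsums f k J}) ->
  (k.+1 < #|J|)%N -> {in J, forall j, subsums_bound f k (J :\ j)} ->
  subsums_bound f k J.
Proof.
move=> aper kJ IH B0 nz _; set B := subsums f k J in aper B0 *.
rewrite leqNgt; apply/negP => small.
pose Bj j := subsums f k (J :\ j).
have cJ j : j \in J -> #|J| = #|J :\ j|.+1 by move=> jJ; rewrite (cardsD1 j) jJ.
have sBj j : Bj j \subset B by apply: subsums_sub; rewrite subsetDl.
have IHj j : j \in J -> (#|J| + #|f @: (J :\ j)| <= #|Bj j|.+1 + k)%N.
  move=> jJ; rewrite (cJ j jJ) !addSn ltnS; apply: (IH j jJ).
  - by apply: contra B0; apply: (subsetP (sBj j)).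
  - by move=> i /setD1P[_ iJ]; apply: nz.
  - by move: kJ; rewrite (cJ j jJ).
(* If deleting [j] lost no sum, adding [f j] would map [B] into itself. *)
have ltB j : j \in J -> (#|Bj j| < #|B|)%N.
  move=> jJ; rewrite ltnNge; apply/negP => le.
  have /eqP E : Bj j == B by rewrite eqEcard sBj le.
  by apply: (aper (f j) (nz j jJ)) => b; rewrite -{1}E; apply: subsumsD1.
(* Deleting a repeated term keeps the support, so the bound for [J :\ j] would contradict [ltB]. *)
have notin j : j \in J -> f j \notin f @: (J :\ j).
  move=> jJ; apply/negP => fj.
  have E : f @: J = f @: (J :\ j).
    by rewrite -{1}(setD1K jJ) imsetU1; apply/setUidPr; rewrite sub1set.
  by have := IHj j jJ; have := ltB j jJ; move: small; rewrite E; lia.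
have finj : {in J &, injective f}.
  move=> i j iJ jJ e; apply/eqP; apply: contraNT (notin j jJ) => ij.
  by rewrite -e; apply: imset_f; rewrite !inE ij.
have cfJ : #|f @: J| = #|J| by apply: card_in_imset.
have cB j : j \in J -> #|B| = #|Bj j|.+1.
  move=> jJ; have := IHj j jJ; have := ltB j jJ.
  rewrite (card_in_imset (sub_in2 _ finj)); last by move=> i /setD1P[].
  by have := cJ j jJ; move: small; rewrite cfJ; lia.
(* [B] has one element outside [Bj j + f j], and every [b] in [B] with
   [b - f j] outside [B] must be that element. *)
have exit1 j b b' : j \in J -> b \in B -> b' \in B -> b - f j \notin B ->
    b' - f j \notin B -> b = b'.
  move=> jJ bB b'B nb nb'; pose C : {set G} := [set x + f j | x in Bj j].
  have CB : C \subset B.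
    by apply/subsetP => _ /imsetP[x xB ->]; apply: subsumsD1.
  have cC : #|C| = #|Bj j| by apply: card_imset; apply: addIr.
  have out x : x \in B -> x - f j \notin B -> x \in B :\: C.
    move=> xB nx; rewrite inE xB andbT; apply: contra nx => /imsetP[z zB ->].
    by rewrite addrK; apply: (subsetP (sBj j)).
  have /cards1P[c E] : #|B :\: C| == 1%N.
    by rewrite cardsD (setIidPr CB) cC (cB j jJ) subSnn.
  have := out b bB nb; have := out b' b'B nb'; rewrite E !inE.
  by move=> /eqP -> /eqP ->.
pose P := [pred W : {set I} | (W \subset J) && (\sum_(i in W) f i \notin B)].
have P0 : P set0 by rewrite /= sub0set big_set0.
have [W /andP[WJ yB] Wmax] := @arg_maxnP _ set0 P (fun W => #|W|) P0.
set y := \sum_(i in W) f i in yB.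
have kW : (#|W| < k)%N.
  by rewrite ltnNge; apply: contra yB => kW; apply: mem_subsums.
have cR : (1 < #|J :\: W|)%N by rewrite cardsD (setIidPr WJ); lia.
have yD u : u \in J :\: W -> y + f u \in B.
  case/setDP=> uJ uW; apply: contraT => nB.
  have := Wmax (u |: W); rewrite /= subUset sub1set uJ WJ big_setU1 //= addrC.
  by move=> /(_ nB); rewrite cardsU1 uW /= add1n /= ltnn.
have exitR u b : u \in J :\: W -> b \in B -> b - f u \notin B -> b = y + f u.
  move=> uR bB nb; apply: (exit1 u); rewrite ?yD ?addrK //.
  by case/setDP: uR.
(* Suppose [y - f u] is outside [B], and compare with a second index [u']. If [y - f u + f u'] is in
   [B], it is the exit along [f u'], forcing [f u = 0]; if not, [y + f u'] is the exit along [f u],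
   forcing [f u' = f u]. *)
have yB' u : u \in J :\: W -> y - f u \in B.
  move=> uR; have [u' u'R u'u] : exists2 u', u' \in J :\: W & u' != u.
    have /card_gt0P[u'] : (0 < #|(J :\: W) :\ u|)%N.
      by move: cR; rewrite (cardsD1 u) uR ltnS.
    by rewrite 2!inE => /andP[? ?]; exists u'.
  apply: contraT => nB.
  have [uJ _] := setDP uR; have [u'J _] := setDP u'R.
  have [b1|b1] := boolP (y - f u + f u' \in B).
    have := exitR u' _ u'R b1; rewrite addrK => /(_ nB) /addIr.
    by rewrite -[RHS]addr0 => /addrI /eqP; rewrite oppr_eq0 (negPf (nz u uJ)).
  have := exitR u _ uR (yD u' u'R); rewrite addrAC => /(_ b1) /addrI /finj e.
  by rewrite e ?eqxx in u'u.
pose D : {set G} := y |: B.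
have DR u : u \in J :\: W -> {in D, forall d, d - f u \in D}.
  move=> uR d /setU1P[->|dB]; first by rewrite setU1r ?yB'.
  have [?|nB] := boolP (d - f u \in B); first exact: setU1r.
  by rewrite (exitR u d uR dB nB) addrK setU11.
(* If [d - f j] left [D], then so would [d - f u - f j] for every [u] outside
   [W]; of the distinct elements [d], [d - f u], [d - f u'], two differ from
   [y], and both would be exits along [f j]. *)
have DJ : {in D & J, forall d j, d - f j \in D}.
  move=> d j dD jJ; apply: contraT => nD.
  have /card_gt1P[u [u' [uR u'R uu']]] := cR.
  have [uJ _] := setDP uR; have [u'J _] := setDP u'R.
  have out x : x - f j \notin D -> x \in D -> x != y ->
      x \in B /\ x - f j \notin B.
    rewrite !inE negb_or => /andP[_ nx] /orP[/eqP ->|xB]; last by [].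
    by rewrite eqxx.
  have shift v : v \in J :\: W -> d - f v - f j \notin D.
    move=> vR; apply: contra nD => /(stable_addr (DR v vR)).
    by rewrite addrAC subrK.
  have d1 v : v \in J -> d != d - f v.
    by move=> vJ; rewrite -subr_eq0 opprB addrCA subrr addr0 nz.
  have d2 : d - f u != d - f u'.
    by rewrite (inj_eq (addrI d)) eqr_opp; apply: contra uu' => /eqP/finj ->.
  have coll a b : a - f j \notin D -> b - f j \notin D -> a \in D -> b \in D ->
      a != b -> a != y -> b != y -> false.
    move=> na nb aD bD ab ay b_y.
    have [aB nfa] := out a na aD ay; have [bB nfb] := out b nb bD b_y.
    by rewrite (exit1 j a b jJ aB bB nfa nfb) eqxx in ab.
  have [dy|dy] := eqVneq d y.
    apply: (coll _ _ (shift u uR) (shift u' u'R)) d2 _ _; rewrite ?DR //.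
      by rewrite -dy eq_sym d1.
    by rewrite -dy eq_sym d1.
  have [duy|duy] := eqVneq (d - f u) y.
    apply: (coll _ _ nD (shift u' u'R) dD _ (d1 u' u'J) dy); rewrite ?DR //.
    by rewrite -duy eq_sym.
  exact: (coll _ _ nD (shift u uR) dD (DR u uR d dD) (d1 u uJ) dy duy).
(* Subtract all the terms, one by one, from their total, which lies in [B]. *)
have D0 : 0 \in D.
  rewrite -(subrr (\sum_(j in J) f j)); apply: stable_sub_sum => //.
  by apply: setU1r; apply: mem_subsums => //; lia.
have cD : #|D| = #|B|.+1 by rewrite cardsU1 yB.
have [|||Y [YX kY sY]] := @zero_sum_subset G D (f @: J) k D0.
- by move=> d _ dD /imsetP[j jJ ->]; apply: DJ.
- by apply/imsetP => -[j jJ /esym/eqP]; rewrite (negPf (nz j jJ)).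
- by rewrite cD cfJ; move: small; rewrite cfJ; lia.
(* Since [f] is injective on [J], [Y] pulls back to an index set of the same size, which puts 0 in
   [B]. *)
have TJ : J :&: f @^-1: Y \subset J by apply: subsetIl.
have TY : f @: (J :&: f @^-1: Y) = Y.
  apply/setP => x; apply/imsetP/idP => [[i] |xY].
    by rewrite !inE => /andP[_ fY] ->.
  have /imsetP[i iJ xi] := subsetP YX x xY.
  by exists i; rewrite // !inE iJ -xi.
have injT : {in J :&: f @^-1: Y &, injective f}.
  by apply: sub_in2 finj; apply/subsetP.
case/negP: B0; rewrite -sY -TY big_imset //=; apply: mem_subsums => //.
by rewrite -(card_in_imset injT) TY.
Qed.

(** * The double induction and the return to multisets *)

Lemma subsums_boundP (G : finZmodType) (I : finType) (f : I -> G) (k : nat)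
    (J : {set I}) :
  subsums_bound f k J.
Proof.
have [n] := ubnP #|G|; elim: n G f k J => // n IHG G f k J /ltnSE cG.
have [m] := ubnP #|J|; elim: m J => // m IHJ J /ltnSE cJ B0 nz kJ.
move: (kJ); rewrite leq_eqVlt => /predU1P[eJ|kJ2].
  exact: subsums_bound_card.
(* This is the stabilizer of the set of sums; by finiteness, closure under addition makes it a
   subgroup. *)
pose stab : {set G} :=
  [set h | [forall b in subsums f k J, b + h \in subsums f k J]].
have stabP h :
    reflect {in subsums f k J, forall b, b + h \in subsums f k J} (h \in stab).
  by rewrite inE; apply: forall_inP.
have gstab : group_set stab.
  apply/group_setP; split=> [|h h' /stabP hs /stabP hs'].
    by apply/stabP => b bB; rewrite addr0.
  by apply/stabP => b bB; rewrite addrA; apply/hs'/hs.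
have [H1|H1] := ltnP 1 #|stab|.
  apply: (@subsums_bound_periodic _ _ _ _ _ (Group gstab)) => //.
    by move=> b h bB /stabP; apply.
  apply: IHG; apply: leq_trans cG.
  have := card_zproj_preim [set: zquot (Group gstab)].
  rewrite preimsetT !cardsT => ->; apply: ltn_Pmull => //.
  by apply/card_gt0P; exists 0.
apply: subsums_bound_aperiodic => //.
  move=> h h0 /stabP hs; move: H1; rewrite leqNgt => /negP; apply.
  apply/card_gt1P; exists 0, h; split => //; last by rewrite eq_sym.
  by apply/stabP => b bB; rewrite addr0.
move=> j jJ; apply: IHJ; apply: leq_trans cJ.
by rewrite [X in (_ < X)%N](cardsD1 j) jJ.
Qed.

Unset Implicit Arguments.

Theorem theorem1p6 (G : finZmodType) (k : nat) (S : {mset G})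
    (k_ge1 : (1 <= k)%N)
    (size_S : (k + 1 <= size S)%N)
    (zero_notin_Sigma : (0 : G) \notin Sigma_ge k S)
    (zero_notin_supp : (0 : G) \notin finsupp S) :
  (#|Sigma_ge k S| >= size S - k + #|` finsupp S|)%N.
Proof.
(* The indices are the positions in [S], so the default value 0 is never returned. *)
pose f (i : 'I_(size S)) : G := nth 0 S i.
have mapf : [seq f i | i <- enum 'I_(size S)] = S.
  by rewrite (map_comp (nth 0 S) val) val_enum_ord map_nth_iota0 // take_size.
(* This one inclusion transfers both the absence of 0 and the lower bound on the cardinality. *)
have sub : subsums f k [set: 'I_(size S)] \subset Sigma_ge k S.
  apply/subsetP => _ /subsumsP[T [_ kT ->]].
  have cT : (#|T| < (size S).+1)%N.
    by rewrite ltnS -[X in (_ <= X)%N]card_ord max_card.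
  rewrite /Sigma_ge (bigD1_seq #|T|) ?iota_uniq //=; last first.
    by rewrite mem_index_iota kT.
  rewrite inE; apply/orP; left; rewrite inE; apply/boolp.asboolP.
  exists (seq_mset [seq f i | i <- enum T]).
  have P := perm_eq_seq_mset [seq f i | i <- enum T].
  split.
  - apply/msubsetP => x; rewrite mset_seqE -count_mem_mset.
    apply: leq_count_subseq; rewrite -[Y in subseq _ Y]mapf map_subseq //.
    by rewrite [X in subseq _ X]enumT; apply: filter_subseq.
  - by rewrite (perm_size P) size_map -cardE.
  - by rewrite /seqsum (perm_big _ P) big_map big_enum.
have imf x : (x \in f @: setT) = (x \in finsupp S).
  have -> : (x \in finsupp S) = (x \in [seq f i | i <- enum 'I_(size S)]).
    by rewrite mapf msuppE.
  apply/imsetP/mapP => -[i _ ->]; exists i; rewrite ?mem_enum //.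
have cf : #|f @: setT| = #|` finsupp S|.
  by rewrite (eq_card imf); apply/card_uniqP/fset_uniq.
have B0 : 0 \notin subsums f k setT.
  by apply: contra zero_notin_Sigma; apply: (subsetP sub).
have nz : {in setT, forall i, f i != 0}.
  by move=> i _; apply: contraNneq zero_notin_supp => <-; rewrite -imf imset_f.
rewrite addn1 in size_S; apply: leq_trans (subset_leq_card sub).
have := subsums_boundP B0 nz; rewrite cardsT card_ord cf => /(_ size_S).
by rewrite addnBAC; [rewrite leq_subLR (addnC k) | exact: ltnW].
Qed.
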